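(* Let $a<b$ be real numbers with $[a,b]\subset\mathbb{R}\setminus\{0\}$, and let $f:[a,b]\to\mathbb{R}$ be symmetrized harmonic convex and integrable on $[a,b]$. Then $$f\left(\frac{2ab}{a+b}\right)\le \frac{ab}{b-a}\int_a^b\frac{f(x)}{x^2}\,dx\le\frac{f(a)+f(b)}{2}.$$
   Context: For an interval $I\subset\mathbb{R}\setminus\{0\}$, a function $g:I\to\mathbb{R}$ is harmonic convex on $I$ if for all $x,y\in I$ and all $\alpha,\beta\ge 0$ with $\alpha+\beta=1$, $g\left(\frac{xy}{\alpha x+\beta y}\right)\le \alpha g(y)+\beta g(x)$. For $f:[a,b]\to\mathbb{R}$ with $[a,b]\subset\mathbb{R}\setminus\{0\}$, the symmetrical transform of $f$ on $[a,b]$ is $\breve f(t)=\frac12\left[f(t)+f\left(\frac{abt}{(a+b)t-ab}\right)\right]$, $t\in[a,b]$. The function $f$ is symmetrized harmonic convex on $[a,b]$ if $\breve f$ is harmonic convex on $[a,b]$. *)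

(* Defs.v *)
From mathcomp Require Import all_boot all_order all_algebra.
From mathcomp Require Import all_classical all_reals all_analysis.

Set Implicit Arguments.
Unset Strict Implicit.
Unset Printing Implicit Defensive.
Import Order.TTheory GRing.Theory Num.Theory.
Import numFieldNormedType.Exports.
Local Open Scope ring_scope.

(* A function on an interval I is represented by a total function R -> R, of
   which only the values on I matter. *)

(* Meant for 0 \notin I: then al * x + be * y is nonzero, as x and y have the
   same sign, and the point x * y / (al * x + be * y) lies in I. *)
Definition harmonic_convex (R : realType) (I : interval R) (g : R -> R) : Prop :=
  forall x y : R, x \in I -> y \in I ->
  forall al be : R, 0 <= al -> 0 <= be -> al + be = 1 ->
    g (x * y / (al * x + be * y)) <= al * g y + be * g x.

(* For 0 \notin `[a, b] and t \in `[a, b], the denominator lies between a ^+ 2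
   and b ^+ 2, and the second argument of f lies in `[a, b]. *)
Definition symmetrical_transform (R : realType) (a b : R) (f : R -> R) (t : R) : R :=
  2^-1 * (f t + f (a * b * t / ((a + b) * t - a * b))).

Definition symmetrized_harmonic_convex (R : realType) (a b : R) (f : R -> R) : Prop :=
  harmonic_convex `[a, b] (symmetrical_transform a b f).

(* Main.v *)
Require Import Defs.
From HB Require Import structures.
From mathcomp Require Import all_boot all_order all_algebra.
From mathcomp Require Import all_classical all_reals all_analysis.
From mathcomp Require Import measurable_realfun ring.
Import Order.TTheory GRing.Theory Num.Theory.
Import numFieldNormedType.Exports.
Local Open Scope classical_set_scope.
Local Open Scope ring_scope.

(** Put s t := a b t / ((a + b) t - a b), so that the symmetrical transform g
    of f satisfies 2 g = f + f o s. In the coordinate 1 / t the map s is the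
    reflection 1 / t |-> 1 / a + 1 / b - 1 / t, which exchanges the endpoints
    1 / a and 1 / b and fixes their midpoint, the inverse of the harmonic mean
    m := 2 a b / (a + b).

    Harmonic convexity is ordinary convexity in the coordinate 1 / t. Hence
    the convex function g, being symmetric under s, is at least its value at
    the fixed point, g m = f m (harmonic_mean_le_transform), and at most its
    common value (f a + f b) / 2 at the endpoints (transform_le_endpoints).

    Let nu be the measure with density t^-2 on [a, b], of total mass
    1 / a - 1 / b = (b - a) / (a b). It is the length in the coordinate 1 / t,
    so it is invariant under the reflection s; therefore the integrals of f
    and of f o s against nu agree, and both equal the integral of g
    (Rintegral_symmetrical_transform). Integrating f m <= g <= (f a + f b) / 2
    against nu and dividing by its mass gives the two inequalities.

    The substantial step is the invariance of nu, since f is merely Lebesgue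
    integrable, while the usual change of variables asks for a continuous f.
    The measures nu and nu o s^-1 agree on the rays ]x, +oo[ by the fundamental
    theorem of calculus, hence on Borel sets by the uniqueness of measures. A
    Lebesgue measurable set is the union of a Borel set and a subset of a
    Borel null set; as the density is positive on [a, b], s^-1 preserves null
    sets there, and both the measurability of s and the invariance extend to
    Lebesgue measurable sets (inv_sqr_measure_reflection). *)

(** The real line with the Lebesgue measurable sets. *)
Local Notation completedR R :=
  (caratheodory_type (wlength (@idfun (Real.sort R)))^*%mu).

(** * Measures with a density *)

(** Taking the two proofs as arguments lets the structure of finite measure be
    inferred from the term itself. *)
Definition density_measure d (T : measurableType d) (R : realType)
    (mu : {measure set T -> \bar R}) (w : T -> R)
    of (forall x, 0 <= w x) & mu.-integrable [set: T] (EFin \o w) :=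
  fun A : set T => (\int[mu]_(x in A) (w x)%:E)%E.
Arguments density_measure {d T R mu w}.

Section density_measure.
Local Open Scope charge_scope.
Local Open Scope ereal_scope.
Context {d} {T : measurableType d} {R : realType}.
Context {mu : {sigma_finite_measure set T -> \bar R}} {w : T -> R}.
Hypothesis w0 : forall x, (0 <= w x)%R.
Hypothesis wi : mu.-integrable [set: T] (EFin \o w).

Local Notation nu := (density_measure w0 wi).

Let mw : measurable_fun [set: T] (fun x => (w x)%:E).
Proof. exact: measurable_int wi. Qed.

Let nu_set0 : nu set0 = 0.
Proof. by rewrite /density_measure integral_set0. Qed.

Let nu_ge0 A : 0 <= nu A.
Proof. by rewrite /density_measure integral_ge0//= => x _; rewrite lee_fin. Qed.

Let nu_sigma_additive : semi_sigma_additive nu.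
Proof.
exact: (@semi_sigma_additive_nng_induced _ _ _ _ (EFin \o w)).
Qed.

HB.instance Definition _ := isMeasure.Build _ _ _ nu
  nu_set0 nu_ge0 nu_sigma_additive.

Let nu_fin : fin_num_fun nu.
Proof.
move=> A mA; apply: integrable_fin_num => //.
exact: (integrableS measurableT).
Qed.

HB.instance Definition _ := Measure_isFinite.Build _ _ _ nu nu_fin.

Lemma null_density_measure A : measurable A -> mu A = 0 -> nu A = 0.
Proof.
by move=> mA A0; apply: null_set_integral => //; exact: measurable_funTS.
Qed.

Lemma density_measure_dominates : nu `<< mu.
Proof. exact/null_content_dominatesP/null_density_measure. Qed.

(** A converse to null_density_measure: a function with zero integral vanishes
    almost everywhere, so the part of a nu-null set where the density is
    nonzero is mu-null. *)
Lemma null_density_support (A B : set T) : measurable A -> measurable B ->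
  nu A = 0 -> B `<=` A -> (forall x, B x -> w x != 0%R) -> mu B = 0.
Proof.
move=> mA mB A0 BA w_neq0.
have : \int[mu]_(x in A) `|(w x)%:E| = 0.
  by rewrite -[RHS]A0; apply: eq_integral => x _; rewrite gee0_abs ?lee_fin.
move/(ae_eq_integral_abs _ mA (measurable_funTS mw)) => [N [mN N0 AN]].
apply: (subset_measure0 mB mN _ N0) => x Bx; apply: AN => /=.
by move=> /(_ (BA _ Bx)) [] /eqP; exact/negP/w_neq0.
Qed.

Lemma Radon_Nikodym_density_measure :
  ae_eq mu setT ('d (charge_of_finite_measure nu) '/d mu) (EFin \o w).
Proof.
apply: integral_ae_eq => //.
- exact/Radon_Nikodym_integrable/density_measure_dominates.
- move=> A _ mA; rewrite -Radon_Nikodym_integral//.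
  exact: density_measure_dominates.
Qed.

Lemma ge0_integral_density_measure (f : T -> \bar R) :
  (forall x, 0 <= f x) -> measurable_fun setT f ->
  \int[nu]_x f x = \int[mu]_x (f x * (w x)%:E).
Proof.
move=> f0 mf; have nu_mu := density_measure_dominates.
rewrite -(Radon_Nikodym_SigmaFinite.change_of_variables nu_mu)//.
have iR := Radon_Nikodym_SigmaFinite.f_integrable nu_mu.
have mR : measurable_fun setT (Radon_Nikodym_SigmaFinite.f nu mu).
  exact: measurable_int iR.
apply: ae_eq_integral => //; [exact: emeasurable_funM..|].
apply: ae_eqe_mul2l; apply: integral_ae_eq => // A _ mA.
by rewrite -Radon_Nikodym_SigmaFinite.f_integral.
Qed.

Lemma integrable_density_measure (f : T -> R) : measurable_fun setT f ->
  mu.-integrable setT (fun x => (f x * w x)%:E) ->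
  nu.-integrable setT (EFin \o f).
Proof.
move=> mf /integrableP[_ fw]; apply/integrableP; split.
  exact/measurable_EFinP.
rewrite ge0_integral_density_measure//; last first.
  by apply/measurableT_comp => //; exact/measurable_EFinP.
move: fw; congr (_ < _); apply: eq_integral => x _ /=.
by rewrite normrM (ger0_norm (w0 x)) EFinM.
Qed.

Lemma integral_density_measure (f : T -> R) : measurable_fun setT f ->
  mu.-integrable setT (fun x => (f x * w x)%:E) ->
  \int[nu]_x (f x)%:E = \int[mu]_x (f x * w x)%:E.
Proof.
move=> mf fw; have nu_mu := density_measure_dominates.
rewrite -(Radon_Nikodym_change_of_variables nu_mu)//; last first.
  exact: integrable_density_measure.
apply: ae_eq_integral => //.
- apply: emeasurable_funM; first exact/measurable_EFinP.
  exact/measurable_int/Radon_Nikodym_integrable.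
- exact: measurable_int fw.
- under [X in ae_eq _ _ _ X]eq_fun do rewrite EFinM.
  exact/ae_eqe_mul2l/Radon_Nikodym_density_measure.
Qed.

End density_measure.

(** * Lebesgue measure on the real line *)

Section completed_lebesgue.
Context {R : realType}.
Local Notation mu := (@lebesgue_measure R).
Local Notation cmu := (@completed_lebesgue_measure R).
Local Notation cR := (completedR R).

Lemma borel_completed_measurable (A : set (measurableTypeR R)) :
  measurable A -> measurable (A : set cR).
Proof. by move=> mA; exact: sub_caratheodory. Qed.

Lemma measurable_fun_borel_completed d (U : measurableType d)
    (D : set (measurableTypeR R)) (g : measurableTypeR R -> U) :
  measurable D -> measurable_fun D g ->
  measurable_fun (D : set cR) (g : cR -> U).
Proof.
move=> mD mg _ Y mY; apply: borel_completed_measurable.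
exact: mg.
Qed.

Lemma measurable_id_completed_borel :
  measurable_fun [set: cR] (idfun : cR -> measurableTypeR R).
Proof.
apply: (@measurable_fun_borel_completed _ (measurableTypeR R) setT idfun).
  exact: measurableT.
exact: measurable_id.
Qed.

(** The Lebesgue measure on Borel sets is the pushforward of its completion
    under the identity. *)
Lemma ge0_integral_completed (D : set (measurableTypeR R))
    (f : measurableTypeR R -> \bar R) :
  measurable D -> measurable_fun D f -> (forall x, D x -> (0 <= f x)%E) ->
  (\int[cmu]_(x in D) f x = \int[mu]_(x in D) f x)%E.
Proof.
move=> mD mf f0; have mid := measurable_id_completed_borel.
have := ge0_integral_pushforward mid cmu mD mf.
rewrite preimage_id => <-; last by move=> x /[!inE] /f0.
exact: eq_measure_integral.
Qed.

Lemma completed_measurableP (A : set R) : measurable (A : set cR) ->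
  exists B N C : set (measurableTypeR R),
    [/\ measurable B, measurable C, mu C = 0%E, N `<=` C & A = B `|` N].
Proof.
move=> mA; have : (completed_algebra_gen mu) A.
  by rewrite -g_sigma_completed_algebra_genE completed_caratheodory_measurable.
by case=> B mB [N [C [mC C0 NC]] <-]; exists B, N, C; split.
Qed.

Lemma completed_measurable_null (N C : set cR) :
  measurable C -> cmu C = 0%E -> N `<=` C -> measurable N.
Proof.
move=> mC C0 NC.
by apply: completed_lebesgue_measure_is_complete; exists C; split.
Qed.

Lemma finite_measure_unique_rays
    (m1 m2 : {measure set (measurableTypeR R) -> \bar R}) :
  (m1 setT < +oo)%E ->
  (forall x, m1 `]x, +oo[%classic = m2 `]x, +oo[%classic) ->
  forall A, measurable A -> m1 A = m2 A.
Proof.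
move=> m1oo m12.
apply: (@measure_unique _ R (measurableTypeR R) (@RGenOInfty.G R)
  (fun k => `](- k%:R), +oo[%classic)) => //.
- exact: RGenOInfty.measurableE.
- move=> _ _ [x ->] [y ->]; exists (Num.max x y).
  by apply/seteqP; split => z /=; rewrite !in_itv/= !andbT gt_max => /andP.
- by move=> k; exists (- k%:R).
- rewrite -subTset => x _; exists (Num.truncn (- x)).+1 => //=.
  by rewrite in_itv/= andbT ltrNl truncnS_gt.
- by move=> _ [x ->].
- by move=> k; rewrite (le_lt_trans _ m1oo)// le_measure ?inE.
Qed.

Lemma within_continuous_inv_sqr (x y : R) : 0 \notin `[x, y] ->
  {within `[x, y], continuous (fun t : R => (t ^+ 2)^-1)}.
Proof.
move=> xy0; apply: continuous_in_subspaceT => t; rewrite inE/= => txy.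
apply: cvgV; last exact: exprn_continuous.
by rewrite sqrf_eq0; apply: contraNneq xy0 => <-.
Qed.

Lemma integral_inv_sqr (x y : R) : x <= y -> 0 \notin `[x, y] ->
  (\int[mu]_(t in `[x, y]) ((t ^+ 2)^-1)%:E = (x^-1 - y^-1)%:E)%E.
Proof.
rewrite le_eqVlt => /predU1P[-> _|xy xy0].
  by rewrite set_itv1 integral_set1 subrr.
have in0 t : t \in `[x, y] -> t != 0.
  by move=> txy; apply: contraNneq xy0 => <-.
have cV t : t \in `[x, y] -> {for t, continuous (fun t : R => - t^-1)}.
  by move=> /in0 t0; apply: cvgN; apply: cvgV => //; exact: cvg_id.
rewrite (@continuous_FTC2 _ _ (fun t => - t^-1))//.
- by rewrite -EFinB opprK addrC.
- exact: within_continuous_inv_sqr.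
- split.
  + move=> t txy; apply: derivableN; apply: derivableV => //.
    by apply: in0; apply: subset_itv_oo_cc.
  + by apply: cvg_at_right_filter; apply: cV; rewrite in_itv/= lexx ltW.
  + by apply: cvg_at_left_filter; apply: cV; rewrite in_itv/= lexx ltW.
- move=> t txy; have t0 : t != 0 by apply: in0; apply: subset_itv_oo_cc.
  rewrite derive1E deriveN ?deriveV//; last exact: derivableV.
  by rewrite derive_id scaleNr opprK -[_ *: _]/(_ * _) mulr1 -exprVn.
Qed.

End completed_lebesgue.

(** * The harmonic reflection of an interval *)

Definition harmonic_reflection {R : realType} (a b t : R) : R :=
  a * b * t / ((a + b) * t - a * b).

Section reflection.
Context {R : realType} {a b : R}.
Hypothesis hab : a < b.
Hypothesis h0 : 0 \notin `[a, b].
Local Notation s := (harmonic_reflection a b).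
Local Notation den t := ((a + b) * t - a * b).

Lemma itv_mul_gt0 x y : x \in `[a, b] -> y \in `[a, b] -> 0 < x * y.
Proof.
rewrite !in_itv/= => /andP[ax xb] /andP[ay yb].
move: h0; rewrite in_itv/= negb_and -!ltNge => /orP[a0|b0].
  by rewrite mulr_gt0// (lt_le_trans a0).
by rewrite nmulr_rgt0 (le_lt_trans _ b0).
Qed.

Lemma itv_neq0 t : t \in `[a, b] -> t != 0.
Proof. by move=> tab; apply: contraNneq h0 => <-. Qed.

Let aab : a \in `[a, b].
Proof. by rewrite in_itv/= lexx ltW. Qed.

Let bab : b \in `[a, b].
Proof. by rewrite in_itv/= lexx ltW. Qed.

Let an0 : a != 0. Proof. exact: itv_neq0. Qed.

Let bn0 : b != 0. Proof. exact: itv_neq0. Qed.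

Lemma reflection_den_gt0 t : t \in `[a, b] -> 0 < den t.
Proof.
move=> /[dup] /itv_neq0 t0; rewrite in_itv/= => /andP[at_ tb].
have -> : den t = t ^+ 2 + (t - a) * (b - t) by ring.
by rewrite ltr_pwDl ?exprn_even_gt0//= mulr_ge0// subr_ge0.
Qed.

Lemma reflectionB x y : x \in `[a, b] -> y \in `[a, b] ->
  s x - s y = (a * b) ^+ 2 * (y - x) / (den x * den y).
Proof.
move=> /reflection_den_gt0 Dx /reflection_den_gt0 Dy.
by rewrite /harmonic_reflection; field; rewrite !gt_eqF.
Qed.

Lemma reflectionl : s a = b.
Proof.
by rewrite /harmonic_reflection; field; exact/lt0r_neq0/reflection_den_gt0.
Qed.

Lemma reflectionr : s b = a.
Proof.
by rewrite /harmonic_reflection; field; exact/lt0r_neq0/reflection_den_gt0.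
Qed.

Lemma reflection_le x y : x \in `[a, b] -> y \in `[a, b] ->
  (s x <= s y) = (y <= x).
Proof.
move=> xab yab; rewrite -subr_ge0 reflectionB// -[RHS]subr_ge0.
rewrite pmulr_lge0 ?invr_gt0 ?mulr_gt0 ?reflection_den_gt0// pmulr_rge0//.
by rewrite exprn_gt0// itv_mul_gt0.
Qed.

Lemma reflection_lt x y : x \in `[a, b] -> y \in `[a, b] ->
  (s x < s y) = (y < x).
Proof. by move=> xab yab; rewrite !ltNge reflection_le. Qed.

Lemma reflection_itv t : t \in `[a, b] -> s t \in `[a, b].
Proof.
move=> tab; have := tab; rewrite !in_itv/= => /andP[at_ tb].
have := reflection_le _ _ bab tab; have := reflection_le _ _ tab aab.
by rewrite reflectionl reflectionr => -> ->; apply/andP.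
Qed.

Lemma reflectionV t : t \in `[a, b] -> (s t)^-1 = a^-1 + b^-1 - t^-1.
Proof.
move=> tab; have /lt0r_neq0 D0 := reflection_den_gt0 t tab.
have t0 := itv_neq0 t tab.
by rewrite /harmonic_reflection; field; rewrite an0 bn0 t0 D0.
Qed.

Lemma reflectionK t : t \in `[a, b] -> s (s t) = t.
Proof.
move=> tab; apply: invr_inj.
by rewrite !reflectionV// ?reflection_itv// opprB addrC subrK.
Qed.

Lemma continuous_reflection t : t \in `[a, b] -> {for t, continuous s}.
Proof.
move=> /reflection_den_gt0/lt0r_neq0 D0.
have cM (c : R) : {for t, continuous ( *%R c)}.
  by apply: cvgM; [exact: cvg_cst|exact: cvg_id].
apply: cvgM; first exact: cM.
by apply: cvgV => //; apply: cvgB; [exact: cM|exact: cvg_cst].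
Qed.

End reflection.

(** * Bounds on the symmetrical transform *)

Section transform_bounds.
Context {R : realType} {a b : R} {f : R -> R}.
Hypothesis hab : a < b.
Hypothesis h0 : 0 \notin `[a, b].
Hypothesis hf : symmetrized_harmonic_convex a b f.
Local Notation s := (harmonic_reflection a b).
Local Notation g := (symmetrical_transform a b f).

Let aab : a \in `[a, b].
Proof. by rewrite in_itv/= lexx ltW. Qed.

Let bab : b \in `[a, b].
Proof. by rewrite in_itv/= lexx ltW. Qed.

Let gE t : g t = 2^-1 * (f t + f (s t)).
Proof. by []. Qed.

Lemma transform_reflection t : t \in `[a, b] -> g (s t) = g t.
Proof. by move=> tab; rewrite !gE (reflectionK hab h0)// [f t + _]addrC. Qed.

(** The harmonic mean of t and s t is that of a and b, so convexity with equal
    weights bounds g there by (g t + g (s t)) / 2 = g t. *)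
Lemma harmonic_mean_le_transform t : t \in `[a, b] ->
  f (2 * a * b / (a + b)) <= g t.
Proof.
move=> tab; have stab := reflection_itv hab h0 t tab.
have an0 := itv_neq0 h0 a aab; have bn0 := itv_neq0 h0 b bab.
have tn0 := itv_neq0 h0 t tab; have stn0 := itv_neq0 h0 _ stab.
have abn0 : a + b != 0.
  have := itv_mul_gt0 h0 a b aab bab; apply: contraTneq => /eqP.
  by rewrite addr_eq0 => /eqP ->; rewrite mulNr -expr2 oppr_gt0 -leNgt sqr_ge0.
have mE : t * s t / (2^-1 * t + 2^-1 * s t) = 2 * a * b / (a + b).
  apply: invr_inj; transitivity (2^-1 * (t^-1 + (s t)^-1)).
    by rewrite invf_div; field; rewrite tn0 stn0.
  rewrite (reflectionV hab h0)// addrC subrK invf_div.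
  by field; rewrite an0 bn0.
have sm : s (2 * a * b / (a + b)) = 2 * a * b / (a + b).
  rewrite /harmonic_reflection; field.
  by rewrite abn0 -mulrA mulr2n mulrDl mul1r addrK mulf_neq0.
have -> : f (2 * a * b / (a + b)) = g (2 * a * b / (a + b)).
  by rewrite gE sm; field.
have := hf t (s t) tab stab 2^-1 2^-1.
have half : 2^-1 + 2^-1 = 1 :> R by field.
rewrite mE transform_reflection// -mulrDl half mul1r.
by apply; rewrite ?invr_ge0.
Qed.

Lemma transform_le_endpoints t : t \in `[a, b] -> g t <= (f a + f b) / 2.
Proof.
move=> tab; have tn0 := itv_neq0 h0 t tab.
have an0 := itv_neq0 h0 a aab; have bn0 := itv_neq0 h0 b bab.
have [at_ tb] : a <= t /\ t <= b by apply/andP; rewrite in_itv in tab.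
have ba0 : b - a != 0 by rewrite subr_eq0 gt_eqF.
(* the barycentric coordinates of 1 / t between 1 / b and 1 / a *)
pose al := b * (t - a) / (t * (b - a)); pose be := a * (b - t) / (t * (b - a)).
have al_be : al + be = 1 by rewrite /al /be; field; rewrite ba0.
have div_gt0 x : x \in `[a, b] -> 0 < x / t.
  move=> xab; have -> : x / t = x * t * t^-1 ^+ 2 by field.
  by rewrite mulr_gt0 ?exprn_even_gt0 ?invr_eq0//= (itv_mul_gt0 h0).
have al0 : 0 <= al.
  have -> : al = (b / t) * ((t - a) / (b - a)).
    by rewrite /al; field; rewrite ba0.
  apply: mulr_ge0; first exact/ltW/div_gt0.
  by apply: divr_ge0; rewrite subr_ge0// ltW.
have be0 : 0 <= be.
  have -> : be = (a / t) * ((b - t) / (b - a)).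
    by rewrite /be; field; rewrite ba0.
  apply: mulr_ge0; first exact/ltW/div_gt0.
  by apply: divr_ge0; rewrite subr_ge0// ltW.
have := hf a b aab bab al be al0 be0 al_be.
have -> : a * b / (al * a + be * b) = t.
  have -> : al * a + be * b = a * b / t.
    by rewrite /al /be; field; rewrite tn0 ba0.
  by field; rewrite tn0 an0 bn0.
have -> : g b = g a by rewrite -(transform_reflection a)// (reflectionl hab h0).
rewrite -mulrDl al_be mul1r => /le_trans; apply.
by rewrite gE (reflectionl hab h0) mulrC.
Qed.

End transform_bounds.

(** * Invariance of the measure with density t^-2 *)

Section invariance.
Context {R : realType} {a b : R}.
Hypothesis hab : a < b.
Hypothesis h0 : 0 \notin `[a, b].
Local Notation mu := (@lebesgue_measure R).
Local Notation cmu := (@completed_lebesgue_measure R).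
Local Notation cR := (completedR R).
Local Notation s := (harmonic_reflection a b).
Local Notation I := (`[a, b]%classic : set R).

(** Extension by zero to the whole line, where pushforwards need their map to
    be defined and measurable. As 0 lies outside [a, b], the extended
    reflection maps the complement of [a, b] into itself. *)
Definition reflection_on : R -> R := s \_ I.

Definition inv_sqr_on : R -> R := (fun t : R => (t ^+ 2)^-1) \_ I.

Local Notation w := inv_sqr_on.
Local Notation s' := reflection_on.

Let mcI : measurable (I : set cR).
Proof. by apply: borel_completed_measurable; exact: measurable_itv. Qed.

Let sub0 x y : a <= x -> y <= b -> 0 \notin `[x, y].
Proof.
move=> ax yb; apply: contraNN h0; rewrite !in_itv/= => /andP[x0 y0].
by rewrite (le_trans ax)// (le_trans y0).
Qed.

Lemma inv_sqr_on_ge0 t : 0 <= w t.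
Proof.
by rewrite /inv_sqr_on patchE; case: ifP => // _; rewrite invr_ge0 sqr_ge0.
Qed.

Lemma measurable_inv_sqr :
  measurable_fun (I : set (measurableTypeR R)) (fun t : R => (t ^+ 2)^-1).
Proof.
apply: subspace_continuous_measurable_fun => //.
exact: within_continuous_inv_sqr.
Qed.

Lemma completed_integral_inv_sqr_on (A : set (measurableTypeR R)) :
  measurable (A `&` I) ->
  (\int[cmu]_(t in A) (w t)%:E =
   \int[mu]_(t in A `&` I) ((t ^+ 2)^-1)%:E)%E.
Proof.
move=> mA; rewrite -ge0_integral_completed//.
- rewrite integral_mkcondr; apply: eq_integral => t _.
  by rewrite restrict_EFin.
- by apply/measurable_EFinP; exact: measurable_funS measurable_inv_sqr.
- by move=> t _; rewrite lee_fin invr_ge0 sqr_ge0.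
Qed.

Lemma integral_inv_sqr_onT : (\int[cmu]_t (w t)%:E = (a^-1 - b^-1)%:E)%E.
Proof.
by rewrite completed_integral_inv_sqr_on setTI// integral_inv_sqr// ltW.
Qed.

Lemma integrable_inv_sqr_on : cmu.-integrable [set: cR] (EFin \o w).
Proof.
apply/integrableP; split.
  apply/measurable_EFinP/(measurable_restrictT _ mcI).
  by apply: measurable_fun_borel_completed => //; exact: measurable_inv_sqr.
under eq_integral do rewrite /= ger0_norm ?inv_sqr_on_ge0//.
by rewrite integral_inv_sqr_onT ltry.
Qed.

Definition inv_sqr_measure : set cR -> \bar R :=
  @density_measure _ cR R cmu w inv_sqr_on_ge0 integrable_inv_sqr_on.
HB.instance Definition _ := FiniteMeasure.on inv_sqr_measure.

Local Notation nu := inv_sqr_measure.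

Lemma inv_sqr_measure_itv : nu I = (a^-1 - b^-1)%:E.
Proof.
rewrite /inv_sqr_measure/= /density_measure completed_integral_inv_sqr_on.
  by rewrite classical_sets.setIid integral_inv_sqr// ltW.
by rewrite classical_sets.setIid; exact: measurable_itv.
Qed.

Lemma measurable_reflection_on_borel :
  measurable_fun [set: cR] (s' : cR -> measurableTypeR R).
Proof.
apply/(measurable_restrictT _ mcI).
apply: measurable_fun_borel_completed => //.
apply: subspace_continuous_measurable_fun => //.
apply: continuous_in_subspaceT => t; rewrite inE/= => tab.
exact: continuous_reflection.
Qed.

(** For x in [a, b] the reflection exchanges ]x, b] and [a, s x[, whose masses
    1 / x - 1 / b and 1 / a - 1 / s x agree by reflectionV. *)
Lemma inv_sqr_measure_reflection_ray x :
  nu (s' @^-1` `]x, +oo[) = nu `]x, +oo[.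
Proof.
have s'E t : t \in `[a, b] -> s' t = s t.
  by move=> tab; rewrite /s' patchE mem_set.
have imI t : t \in `[a, b] -> a <= s t <= b.
  by move=> /(reflection_itv hab h0); rewrite in_itv.
rewrite /nu/= /density_measure.
have [xa|ax] := ltP x a.
  have E1 : s' @^-1` `]x, +oo[ `&` I = I.
    apply/seteqP; split => [t []//|t tI]; split => //=.
    rewrite s'E// in_itv/= andbT (lt_le_trans xa)//.
    by have /andP[] := imI t tI.
  have E2 : `]x, +oo[ `&` I = I.
    apply/seteqP; split => [t []//|t tI]; split => //=; move: tI.
    by rewrite /= !in_itv/= andbT => /andP[at_ _]; rewrite (lt_le_trans xa).
  by rewrite !completed_integral_inv_sqr_on ?E1 ?E2.
have [bx|xb] := leP b x.
  have E1 : s' @^-1` `]x, +oo[ `&` I = set0.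
    apply/seteqP; split => // t [/= + tI].
    rewrite s'E// in_itv/= andbT => xst; have /andP[_] := imI t tI.
    by rewrite leNgt (le_lt_trans bx).
  have E2 : `]x, +oo[ `&` I = set0.
    apply/seteqP; split => // t /= []; rewrite !in_itv/= andbT => xt /andP[_].
    by rewrite leNgt (le_lt_trans bx).
  by rewrite !completed_integral_inv_sqr_on ?E1 ?E2.
have xab : x \in `[a, b] by rewrite in_itv/= ax ltW.
have sxab : s x \in `[a, b] by exact: reflection_itv.
have /andP[asx sxb] := imI x xab.
have E1 : s' @^-1` `]x, +oo[ `&` I = `[a, s x[%classic.
  apply/seteqP; split => t /=.
    move=> [+ tI]; rewrite s'E// !in_itv/= andbT => xst.
    rewrite -(reflection_lt hab h0)// (reflectionK hab h0)// xst andbT.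
    by move: tI; rewrite in_itv => /andP[].
  rewrite in_itv/= => /andP[at_ tsx].
  have tab : t \in `[a, b] by rewrite in_itv/= at_ (le_trans (ltW tsx)).
  split => //; rewrite s'E// in_itv/= andbT -[x](reflectionK hab h0)//.
  by rewrite (reflection_lt hab h0).
have E2 : `]x, +oo[ `&` I = `]x, b]%classic.
  apply/seteqP; split => t /=; rewrite !in_itv/= andbT.
    by move=> [-> /andP[]].
  by move=> /andP[xt tb]; rewrite xt tb (le_trans ax (ltW xt)).
rewrite !completed_integral_inv_sqr_on ?E1 ?E2//.
rewrite integral_itv_bndo_bndc; last first.
  apply/measurable_EFinP; apply: measurable_funS measurable_inv_sqr => //.
  by apply: subset_itvl; rewrite bnd_simp.
rewrite integral_itv_obnd_cbnd; last first.
  apply/measurable_EFinP; apply: measurable_funS measurable_inv_sqr => //.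
  by apply: subset_itvr; rewrite bnd_simp.
rewrite !integral_inv_sqr ?sub0 ?(ltW xb)// (reflectionV hab h0)//.
by congr EFin; ring.
Qed.

Lemma inv_sqr_measure_reflection_borel (A : set (measurableTypeR R)) :
  measurable A -> nu (s' @^-1` A) = nu A.
Proof.
have ms := measurable_reflection_on_borel.
have mid := @measurable_id_completed_borel R.
apply: (finite_measure_unique_rays
  (pushforward nu (s' : cR -> measurableTypeR R))
  (pushforward nu (idfun : cR -> measurableTypeR R))) => //.
- apply: (@le_lt_trans _ _ (nu setT)) => //.
  by rewrite /nu/= /density_measure integral_inv_sqr_onT ltry.
- exact: inv_sqr_measure_reflection_ray.
Qed.

Lemma measurable_reflection_on : measurable_fun [set: cR] (s' : cR -> cR).
Proof.
apply/(measurable_restrictT _ mcI) => _ A.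
move=> /completed_measurableP [B [N [C [mB mC C0 NC ->]]]].
have ms : measurable_fun (I : set cR) (s : cR -> measurableTypeR R).
  exact/(measurable_restrictT _ mcI)/measurable_reflection_on_borel.
rewrite preimage_setU setIUr; apply: measurableU; first exact: ms.
have mcC : measurable (C : set cR) by exact: borel_completed_measurable.
(* s^-1 C is null for nu by invariance on Borel sets, hence null for the
   Lebesgue measure within [a, b], and completeness applies to its subsets *)
apply: (completed_measurable_null _ (I `&` s @^-1` C)).
- exact: ms.
- apply: (@null_density_support _ cR R cmu w inv_sqr_on_ge0
    integrable_inv_sqr_on (s' @^-1` C)).
  + by rewrite -[X in measurable X]setTI; exact: measurable_reflection_on_borel.
  + exact: ms.
  + rewrite -[LHS]/(nu _) inv_sqr_measure_reflection_borel//.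
    exact: null_density_measure.
  + by move=> t [tI sC] /=; rewrite /reflection_on patchE mem_set.
  + move=> t [tI _]; rewrite /inv_sqr_on patchE mem_set//.
    by rewrite invr_eq0 sqrf_eq0 (itv_neq0 h0).
- by move=> t [tI Nst]; split => //; exact: NC.
Qed.

Lemma inv_sqr_measure_reflection (A : set cR) :
  measurable A -> nu (s' @^-1` A) = nu A.
Proof.
move=> /completed_measurableP [B [N [C [mB mC C0 NC ->]]]].
have mcB : measurable (B : set cR) by exact: borel_completed_measurable.
have mcC : measurable (C : set cR) by exact: borel_completed_measurable.
have mcN : measurable (N : set cR) by exact: (completed_measurable_null _ C).
have nuC : nu C = 0%E by exact: null_density_measure.
have msX (X : set cR) : measurable X -> measurable (s' @^-1` X : set cR).
  move=> mX; rewrite -[X in measurable X]setTI.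
  exact: measurable_reflection_on.
rewrite preimage_setU !measureU0//.
- exact: inv_sqr_measure_reflection_borel.
- exact: (subset_measure0 mcN mcC NC nuC).
- exact: msX.
- exact: msX.
- have sNC : s' @^-1` N `<=` s' @^-1` C by move=> t; exact: NC.
  apply: (subset_measure0 (msX _ mcN) (msX _ mcC) sNC).
  by rewrite -nuC; exact: inv_sqr_measure_reflection_borel.
Qed.

End invariance.

(** * Integrals of a function and of its symmetrical transform *)

Section integral_transform.
Context {R : realType} {a b : R} {f : R -> R}.
Hypothesis hab : a < b.
Hypothesis h0 : 0 \notin `[a, b].
Local Notation cmu := (@completed_lebesgue_measure R).
Local Notation cR := (completedR R).
Hypothesis hint : cmu.-integrable `[a, b] (EFin \o f).

Local Notation I := (`[a, b]%classic : set cR).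
Local Notation nu := (inv_sqr_measure hab h0).
Local Notation w := (@inv_sqr_on R a b : cR -> R).
Local Notation s' := (@reflection_on R a b : cR -> cR).
Local Notation F := ((f : cR -> R) \_ I).

Let mI : measurable I.
Proof. by apply: borel_completed_measurable; exact: measurable_itv. Qed.

Let mF : measurable_fun [set: cR] F.
Proof.
apply/(measurable_restrictT _ mI)/measurable_EFinP.
exact: measurable_int hint.
Qed.

Let ms : measurable_fun [set: cR] s'.
Proof. exact: measurable_reflection_on. Qed.

Let integrable_div_sqr : cmu.-integrable I (fun x => (f x / x ^+ 2)%:E).
Proof.
have mh : measurable_fun I (fun t : cR => (t ^+ 2)^-1 : R).
  apply: measurable_fun_borel_completed; first exact: measurable_itv.
  exact: measurable_inv_sqr.
have bh : [bounded (t ^+ 2)^-1 : R | t in I].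
  have /compact_bounded[M [Mr hM]] := continuous_compact
    (within_continuous_inv_sqr a b h0) (@segment_compact _ a b).
  by exists M; split => // x Mx t It; apply: (hM x Mx); exists t.
have := integrableMr mI mh bh hint.
by congr (_.-integrable _ _); apply/funext => t /=; rewrite mulrC EFinM.
Qed.

Let FwE x : F x * w x = ((fun x => f x / x ^+ 2) \_ I) x.
Proof. by rewrite /inv_sqr_on !patchE; case: ifPn; rewrite ?mul0r. Qed.

Let integrable_Fw : cmu.-integrable setT (fun x => (F x * w x)%:E).
Proof.
have -> : (fun x => (F x * w x)%:E) = (fun x => (f x / x ^+ 2)%:E) \_ I.
  by rewrite [RHS]restrict_EFin; apply/funext => x /=; rewrite FwE.
exact: (iffLR (integrable_mkcond _ mI) integrable_div_sqr).
Qed.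

Lemma Rintegral_div_sqr :
  \int[cmu]_(x in I) (f x / x ^+ 2) = \int[nu]_x F x.
Proof.
rewrite Rintegral_mkcond /Rintegral.
rewrite [in RHS]/inv_sqr_measure integral_density_measure//.
by congr fine; apply: eq_integral => x _; rewrite FwE.
Qed.

Let integrableF : nu.-integrable [set: cR] (EFin \o F).
Proof. exact: integrable_density_measure. Qed.

Let integrableFs : nu.-integrable [set: cR] (EFin \o (F \o s')).
Proof.
apply/integrableP; split.
  by apply/measurable_EFinP; exact: measurableT_comp.
have mnF : measurable_fun [set: cR] (fun x => `|F x|%:E).
  by apply/measurable_EFinP; exact: measurableT_comp.
rewrite -(@ge0_integral_pushforward _ _ _ _ _ _ ms nu setT _ measurableT mnF)//.
have /integrableP[_] := integrableF; apply: le_lt_trans.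
rewrite (eq_measure_integral nu)// => A mA _.
exact: inv_sqr_measure_reflection.
Qed.

Lemma Rintegral_reflection : \int[nu]_x F x = \int[nu]_x F (s' x).
Proof.
have mEF : measurable_fun [set: cR] (EFin \o F) by exact/measurable_EFinP.
have := @integral_pushforward _ _ _ _ _ _ ms nu setT _ mEF integrableFs
  measurableT.
rewrite [X in X = _ -> _](eq_measure_integral nu); last first.
  by move=> A mA _; exact: inv_sqr_measure_reflection.
by move=> E; congr fine.
Qed.

Lemma Rintegral_symmetrical_transform :
  \int[cmu]_(x in I) (f x / x ^+ 2) =
  \int[nu]_(x in I) symmetrical_transform a b f x.
Proof.
have Fs : \int[nu]_x F x = \int[nu]_x (2^-1 * (F x + F (s' x))).
  rewrite RintegralZl//; last first.
    exact: (integrableD measurableT integrableF integrableFs).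
  by rewrite RintegralD// -Rintegral_reflection; field.
rewrite Rintegral_div_sqr Fs [RHS]Rintegral_mkcond.
apply: eq_Rintegral => x _; rewrite /reflection_on !patchE.
case: ifPn => xI.
  by rewrite ifT// inE; apply: reflection_itv => //; rewrite inE in xI.
(* outside [a, b] the extended reflection takes the value 0, where F is 0 *)
by rewrite ifF ?addr0 ?mulr0// memNset//; exact/negP.
Qed.

Lemma integrable_symmetrical_transform :
  nu.-integrable I (fun x => (symmetrical_transform a b f x)%:E).
Proof.
have : nu.-integrable I (fun x => (2^-1 * (F x + F (s' x)))%:E).
  apply: (integrableS measurableT) => //.
  under eq_fun do rewrite EFinM.
  apply: integrableZl => //.
  exact: (integrableD measurableT integrableF integrableFs).
apply: eq_integrable => // x xI; rewrite /reflection_on !patchE xI ifT//.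
by rewrite inE; apply: reflection_itv => //; rewrite inE in xI.
Qed.

End integral_transform.

(** * The Hermite-Hadamard inequality *)

Theorem theorem1 (R : realType) (a b : R) (f : R -> R)
  (hab : a < b) (h0 : 0 \notin `[a, b])
  (hf : symmetrized_harmonic_convex a b f)
  (* completed measure: integrability means Lebesgue integrability, and does
     not require f to be Borel measurable *)
  (hint : (@completed_lebesgue_measure R).-integrable `[a, b] (EFin \o f)) :
  f (2 * a * b / (a + b))
    <= a * b / (b - a)
       * \int[@completed_lebesgue_measure R]_(x in `[a, b]) (f x / x ^+ 2)
  /\ a * b / (b - a)
       * \int[@completed_lebesgue_measure R]_(x in `[a, b]) (f x / x ^+ 2)
    <= (f a + f b) / 2.
Proof.
set I := `[a, b]%classic : set R.
have mI : measurable (I : set (completedR R)).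
  by apply: borel_completed_measurable; exact: measurable_itv.
have aab : a \in `[a, b] by rewrite in_itv/= lexx ltW.
have bab : b \in `[a, b] by rewrite in_itv/= lexx ltW.
have ab0 : 0 < a * b by exact: (itv_mul_gt0 h0).
have an0 := itv_neq0 h0 a aab; have bn0 := itv_neq0 h0 b bab.
have ba0 : b - a != 0 by rewrite subr_eq0 gt_eqF.
rewrite (Rintegral_symmetrical_transform hab h0 hint).
set nu := inv_sqr_measure hab h0.
have gi := integrable_symmetrical_transform hab h0 hint.
have ci c : nu.-integrable I (EFin \o cst c).
  exact: finite_measure_integrable_cst.
have nuI : a^-1 - b^-1 = fine (nu I).
  exact: (esym (congr1 fine (inv_sqr_measure_itv hab h0))).
have cE c : c = a * b / (b - a) * \int[nu]_(_ in I) c.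
  transitivity (a * b / (b - a) * (c * (a^-1 - b^-1))).
    by field; rewrite an0 bn0 ba0.
  by congr (_ * _); rewrite Rintegral_cst//; congr (_ * _).
have k0 : 0 <= a * b / (b - a) by apply: divr_ge0; rewrite ?subr_ge0 ltW.
split.
- rewrite [leLHS]cE ler_wpM2l//; apply: (le_Rintegral mI (ci _) gi) => x xI.
  exact: harmonic_mean_le_transform.
- rewrite [leRHS]cE ler_wpM2l//; apply: (le_Rintegral mI gi (ci _)) => x xI.
  exact: transform_le_endpoints.
Qed.
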